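(* Let $G$ be a finite group and let $\pi$ be a set of primes with $2\in\pi$. Let $\sigma=\pi\setminus\{2\}$. Suppose that $d_\pi(G)>1/2$. Then $G$ has a normal $\pi$-complement and an abelian Hall $\sigma$-subgroup.
   Context: For a set of primes $\pi$, a $\pi$-element is an element whose order is divisible only by primes in $\pi$ (including the identity). $k_\pi(G)$ denotes the number of conjugacy classes of $G$ consisting of $\pi$-elements, $|G|_\pi$ is the $\pi$-part of $|G|$ (the largest divisor of $|G|$ all of whose prime factors lie in $\pi$), and $d_\pi(G)=k_\pi(G)/|G|_\pi$. A normal $\pi$-complement of $G$ is a normal subgroup $N$ such that no prime in $\pi$ divides $|N|$ and $|G:N|=|G|_\pi$. A Hall $\sigma$-subgroup of $G$ is a subgroup of order $|G|_\sigma$. *)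

(* Defs.v *)
From HB Require Import structures.
From mathcomp Require Import all_boot all_order all_algebra all_fingroup all_solvable.

Set Implicit Arguments.
Unset Strict Implicit.
Unset Printing Implicit Defensive.

Local Open Scope group_scope.

Definition pi_class_number (gT : finGroupType) (pi : nat_pred) (G : {group gT}) : nat :=
  #|[set C in classes G | [forall x in C, pi.-elt x]]|.

Definition pi_class_density (gT : finGroupType) (pi : nat_pred) (G : {group gT}) : rat :=
  ((pi_class_number pi G)%:R / (#|G|`_pi)%:R)%R.

(* [pi^'.-group N] says that no prime in [pi] divides [#|N|]. *)
Definition normal_pi_complement (gT : finGroupType) (pi : nat_pred)
    (G N : {group gT}) : bool :=
  [&& N <| G, pi^'.-group N & #|G : N| == (#|G|`_pi)%N].

(* Main.v *)
(* Write [d_pi(G)] for the density.  Decomposing a [pi]-element as the product of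
   its commuting [p]- and [p']-parts shows that [d_pi(G) <= d_p(G)] for every [p]
   in [pi], so all these [d_p(G)] exceed 1/2.  Let [S] be a Sylow [p]-subgroup.
   If [p] is odd and [S] is not abelian, then |S : Z(S)| >= 4 and the noncentral
   classes of [S] have size at least 3, whence [d_p(G) <= 1/2].  If some
   [q]-subgroup ([q] an odd prime, [q != p]) normalises but does not centralise a
   [p]-subgroup, then a Frattini argument gives such an action on some [R] with
   Z(S) <= R <= S.  This action fixes at most |R|/4 points and its other orbits
   have size at least 3, so at most |R|/2 classes of [G] meet [R]; elements of [S]
   outside [R] are not central in [S], so again [d_p(G) <= 1/2].
   Hence Frobenius' normal p-complement theorem applies to [G] for [p = 2], and to
   [N = O_2'(G)] for every odd [p] in [pi].  The intersection of these complements
   in [N] is the required normal subgroup; its quotient in [N] is abelian and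
   lifts to the Hall subgroup by Schur-Zassenhaus. *)

Require Import Defs.
From mathcomp Require Import all_boot all_order all_algebra all_fingroup all_solvable.
From mathcomp Require Import zify.

Local Open Scope group_scope.

Lemma leq_card_fibres (aT rT : finType) (f : aT -> rT) (A : {set aT}) m :
    {in A, forall x, m <= #|[set y in A | f y == f x]|} ->
  m * #|f @: A| <= #|A|.
Proof.
move=> fib; rewrite -[X in _ <= X]sum1_card (partition_big_imset f) /=.
rewrite mulnC -sum_nat_const; apply: leq_sum => _ /imsetP[x Ax ->].
by apply: leq_trans (fib x Ax) _; rewrite sum1dep_card.
Qed.

(** * Class numbers of pi-elements and the comparison of d_pi with d_p *)

Section PiClasses.

Import GRing.Theory Num.Theory.

Set Implicit Arguments.
Unset Strict Implicit.

Variables (gT : finGroupType).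
Implicit Types (G H : {group gT}) (pi : nat_pred).

Lemma pi_class_numberE pi G :
  pi_class_number pi G = #|[set x ^: G | x in G & pi.-elt x]|.
Proof.
apply: eq_card => C; rewrite inE; apply/andP/imsetP => [[/imsetP[x Gx ->]] | [x]].
  by move/forall_inP/(_ x (class_refl G x)) => pix; exists x; rewrite // inE Gx.
rewrite inE => /andP[Gx pix] ->; split; first exact: imset_f.
by apply/forall_inP=> _ /imsetP[y _ ->]; rewrite p_eltJ.
Qed.

(** Each class of pi-elements contributes [#|x ^: G| * #|'C_G[x]| = #|G|]. This turns class numbers
    into sums over elements, which can be regrouped by p-part. *)
Lemma sum_card_cent1_pi pi G :
  (\sum_(x in G | pi.-elt x) #|'C_G[x]| = #|G| * pi_class_number pi G)%N.
Proof.
rewrite pi_class_numberE mulnC -sum_nat_const.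
rewrite (eq_bigl (fun x => x \in [set x in G | pi.-elt x])); last first.
  by move=> x; rewrite inE.
rewrite (partition_big_imset (fun x => x ^: G)) /=.
apply: eq_bigr => _ /imsetP[x /[!inE]/andP[Gx pix] ->].
rewrite (eq_bigl (mem (x ^: G))) => [|y]; last first.
  rewrite inE /=; apply/andP/idP => [[_ /eqP <-] | /imsetP[g Gg ->]].
    exact: class_refl.
  by rewrite groupJ // p_eltJ pix classGidl.
rewrite (eq_bigr (fun=> #|'C_G[x]|)) => [|_ /imsetP[g Gg ->]]; last first.
  by rewrite -[RHS](cardJg _ g) conjIg conjGid // cent1J.
by rewrite sum_nat_const -index_cent1 mulnC Lagrange ?subsetIl.
Qed.

(** Each pi-element is uniquely [u * v] with [u] a p-element and [v] a p'-element of ['C_G[u]], and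
    its centraliser is that of [v] in ['C_G[u]]. For fixed [u], summing centraliser orders over [v]
    gives [#|'C_G[u]|] times a class number of ['C_G[u]]. *)
Lemma pi_class_number_constt p pi G M : p \in pi ->
    {in G, forall x, pi_class_number [predD1 pi & p] 'C_G[x] <= M} ->
  pi_class_number pi G <= pi_class_number p G * M.
Proof.
move=> pi_p leM; rewrite -(leq_pmul2l (cardG_gt0 G)) mulnA -!sum_card_cent1_pi.
rewrite big_distrl /=.
rewrite (partition_big (fun x => x.`_p) (fun u => (u \in G) && p.-elt u)); last first.
  by move=> x /andP[Gx _]; rewrite groupX // p_elt_constt.
apply: leq_sum => u /andP[Gu pu].
apply: leq_trans (leq_mul (leqnn _) (leM u Gu)).
rewrite -sum_card_cent1_pi.
rewrite (reindex_onto (fun v => u * v) (fun x => u^-1 * x)) /=; last first.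
  by move=> x _; rewrite mulKVg.
apply: eq_leq; apply: eq_big => [v | v].
  rewrite mulKg eqxx andbT in_setI groupMl //.
  apply/andP/andP => [[/andP[Gv piuv] /eqP uvp] | [/andP[Gv cuv] pip'v]].
    have defv: v = (u * v).`_p^' by apply: (mulgI u); rewrite -{2}uvp consttC.
    have cuv: commute u v.
      by rewrite defv -{1}uvp; apply: (centsP (cycle_abelian (u * v))); apply: mem_cycle.
    rewrite Gv; split; first exact/cent1P.
    rewrite defv; apply/(pnatP _ (order_gt0 _)) => q q_pr q_dv.
    have /pnatP := p_elt_constt p^' (u * v) => /(_ (order_gt0 _) q q_pr q_dv).
    rewrite !inE => ->.
    have: pi.-elt ((u * v).`_p^') by apply: p_eltX.
    by move/pnatP => /(_ (order_gt0 _) q q_pr q_dv).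
  have cuv' : commute u v by apply/commute_sym/cent1P.
  rewrite Gv; split; last first.
    rewrite consttM // (constt_p_elt pu) (constt1P _) ?mulg1 //.
    by apply: sub_in_pnat pip'v => q _; rewrite !inE => /andP[].
  rewrite p_eltM //.
    by apply: sub_in_pnat pu => q _; rewrite !inE => /eqP->.
  by apply: sub_in_pnat pip'v => q _; rewrite !inE => /andP[].
case/andP=> /andP[/andP[Guv piuv] /eqP uvp] _; apply: eq_card => y.
rewrite !in_setI -andbA; congr (_ && _).
have defv: v = (u * v).`_p^' by apply: (mulgI u); rewrite -{2}uvp consttC.
apply/idP/andP=> [/cent1P cy | [/cent1P cyu /cent1P cyv]]; last first.
  by apply/cent1P; apply: commuteM.
by split; apply/cent1P; [rewrite -uvp | rewrite defv]; apply: commuteX.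
Qed.

Lemma pi_class_number_Sylow p G (P : {group gT}) : p.-Sylow(G) P ->
  pi_class_number p G <= #|[set x ^: G | x in P]|.
Proof.
move=> sylP; rewrite pi_class_numberE; apply: subset_leq_card.
apply/subsetP=> _ /imsetP[x /[!inE]/andP[Gx px] ->].
have [|y Gy] := Sylow_Jsub sylP (_ : <[x]> \subset G) px; first by rewrite cycle_subG.
by rewrite -cycleJ cycle_subG => Pxy; apply/imsetP; exists (x ^ y); rewrite ?classGidl.
Qed.

Lemma part_predD1 p pi n : prime p -> p \in pi -> (n`_pi = n`_p * n`_[predD1 pi & p])%N.
Proof.
case: n => [|n]; first by rewrite !partn0.
move=> p_pr pi_p; rewrite -(partnC p (part_gt0 pi n.+1)) -!partnI.
congr (_ * _)%N; apply: eq_partn => q; rewrite !inE.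
  by case: eqP => [->|]; rewrite ?andbF ?andbT.
by rewrite andbC.
Qed.

(** Induction on the pi-part, splitting off a prime [p] that divides it: classes of p-elements
    number at most the Sylow order, and dropping [p] strictly lowers the pi-part, also in
    centralisers. *)
Lemma pi_class_number_le pi G : pi_class_number pi G <= #|G|`_pi.
Proof.
have [n] := ubnP #|G|`_pi; elim: n => // n IHn in pi G *; rewrite ltnS => le_n.
have [pi'G | ] := boolP (pi^'.-group G).
  rewrite pi_class_numberE; apply: leq_trans (part_gt0 pi #|G|).
  rewrite -(cards1 (1 ^: G)); apply/subset_leq_card/subsetP=> C.
  case/imsetP=> x /[!inE]/andP[Gx pix] ->.
  suff -> : x = 1 by [].
  by rewrite -(constt_p_elt pix); apply/constt1P; apply: mem_p_elt pi'G Gx.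
rewrite -partG_eq1 => ntpi.
have p_pr: prime (pdiv (#|G|`_pi)).
  by apply: pdiv_prime; rewrite ltn_neqAle eq_sym ntpi part_gt0.
set p := pdiv _ in p_pr; have p_dv: p %| #|G|`_pi by apply: pdiv_dvd.
have pi_p: p \in pi by move/pnatP: (part_pnat pi #|G|); apply=> //.
have pG: p %| #|G| by apply: dvdn_trans p_dv (dvdn_part _ _).
have [P sylP] := Sylow_exists p G.
have lep: pi_class_number p G <= #|G|`_p.
  rewrite -(card_Hall sylP) (leq_trans (pi_class_number_Sylow sylP)) //.
  exact: leq_imset_card.
rewrite (part_predD1 _ p_pr pi_p); apply: leq_trans (leq_mul lep (leqnn _)).
have lt1p : 1 < #|G|`_p by rewrite p_part_gt1 mem_primes p_pr cardG_gt0.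
apply: pi_class_number_constt => // x Gx.
have leC: #|'C_G[x]|`_[predD1 pi & p] <= #|G|`_[predD1 pi & p].
  by rewrite dvdn_leq ?partn_dvd ?cardSg ?subsetIl.
apply: leq_trans (leC); apply: IHn; apply: leq_trans le_n.
rewrite (part_predD1 _ p_pr pi_p); apply: leq_ltn_trans leC _.
by rewrite ltn_Pmull ?part_gt0.
Qed.

Lemma pi_class_density_gt_half_prime p pi G : prime p -> p \in pi ->
    (1 / 2 < pi_class_density pi G)%R ->
  #|G|`_p < 2 * pi_class_number p G.
Proof.
move=> p_pr pi_p; rewrite /pi_class_density.
have le_pi': {in G, forall x,
    pi_class_number [predD1 pi & p] 'C_G[x] <= #|G|`_[predD1 pi & p]}.
  move=> x Gx; apply: leq_trans (pi_class_number_le _ _) _.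
  by rewrite dvdn_leq ?part_gt0 ?partn_dvd ?cardSg ?subsetIl.
have gt0 : (0 < (#|G|`_pi)%:R :> rat)%R by rewrite ltr0n part_gt0.
rewrite ltr_pdivlMr // mulrC mulrA mulr1 ltr_pdivrMr //.
rewrite -natrM ltr_nat (part_predD1 _ p_pr pi_p) => lt_pi.
have := leq_trans lt_pi (leq_mul (pi_class_number_constt pi_p le_pi') (leqnn 2)).
by rewrite mulnAC ltn_pmul2r ?part_gt0 // mulnC.
Qed.

End PiClasses.

(** * Counting the classes of G that meet a p-subgroup *)

Section Fusion.

Set Implicit Arguments.
Unset Strict Implicit.

Variable gT : finGroupType.
Implicit Types (G P Q R A : {group gT}) (p q : nat).

(** Outside ['C_R(A)] the orbits of [A] have odd length above 1, hence at least 3. With c fixed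
    points and r = [#|R|], there are at most c + (r - c)/3 classes, which is at most r/2 when 4c <=
    r. *)
Lemma odd_fusion_bound G R A : A \subset G -> A \subset 'N(R) -> odd #|A| ->
  4 * #|'C_R(A)| <= #|R| -> 2 * #|[set x ^: G | x in R]| <= #|R|.
Proof.
move=> sAG nRA oddA le4; set C := 'C_R(A) in le4.
have leRC: 3 * #|[set x ^: G | x in R :\: C]| <= #|R :\: C|.
  apply: leq_card_fibres => x /setDP[Rx C'x].
  have sub: x ^: A \subset [set y in R :\: C | y ^: G == x ^: G].
    apply/subsetP=> _ /imsetP[a Aa ->].
    rewrite inE classGidl ?(subsetP sAG) // eqxx andbT.
    have nCa: a \in 'N(C).
      by apply: (subsetP _ a Aa); rewrite normsI ?norms_cent ?normG.
    by rewrite in_setD !memJ_norm ?(subsetP nRA) // C'x.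
  apply: leq_trans (subset_leq_card sub).
  have: odd #|x ^: A| by rewrite -index_cent1 (dvdn_odd (dvdn_indexg _ _)).
  have: #|x ^: A| != 1%N.
    apply: contra C'x => /cards1P[y xAy]; rewrite inE Rx; apply/cent_classP.
    by rewrite xAy; congr [set _]; apply/esym/set1P; rewrite -xAy class_refl.
  by case: #|_| => [|[|[|]]].
have leC := leq_imset_card (fun x => x ^: G) C.
have sCR: C \subset R by apply: subsetIl.
have cardD := cardsID C R; rewrite (setIidPr sCR) in cardD.
have leR: #|[set x ^: G | x in R]| <=
    #|[set x ^: G | x in C]| + #|[set x ^: G | x in R :\: C]|.
  by rewrite -{1}(setID R C) (setIidPr sCR) imsetU leq_card_setU.
have arith i c c' j d r : i <= c' + j -> c' <= c -> 3 * j <= d -> c + d = r ->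
  4 * c <= r -> 2 * i <= r by lia.
exact: arith leR leC leRC cardD le4.
Qed.

Lemma center_fusion_bound G P R : P \subset G -> R \subset P -> 'Z(P) \subset R ->
    2 * #|[set x ^: G | x in R]| <= #|R| ->
  2 * #|[set x ^: G | x in P]| <= #|P|.
Proof.
move=> sPG sRP sZR leR; set I := imset _ _ in leR.
(* Elements whose class misses [R]. They are not central in [P], so each one's [P]-class, which
   stays in [B], has at least two members. *)
pose B := [set x in P | x ^: G \notin I].
have leB: 2 * #|[set x ^: G | x in B]| <= #|B|.
  apply: leq_card_fibres => x; rewrite inE => /andP[Px Ix].
  have sub: x ^: P \subset [set y in B | y ^: G == x ^: G].
    apply/subsetP=> _ /imsetP[a Pa ->]; rewrite !inE.
    by rewrite classGidl ?(subsetP sPG) // eqxx Ix andbT groupJ.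
  apply: leq_trans (subset_leq_card sub).
  rewrite ltn_neqAle eq_sym card_gt0 andbC; apply/andP; split.
    by apply/set0Pn; exists x; apply: class_refl.
  apply: contra Ix => /cards1P[y xPy]; apply/imset_f/(subsetP sZR).
  rewrite inE Px; apply/cent_classP.
  by rewrite xPy; congr [set _]; apply/esym/set1P; rewrite -xPy class_refl.
have sBPR: B \subset P :\: R.
  apply/subsetP=> x; rewrite !inE => /andP[-> Ix]; rewrite andbT.
  by apply: contra Ix => Rx; apply: imset_f.
have leP: #|[set x ^: G | x in P]| <= #|I| + #|[set x ^: G | x in B]|.
  apply: leq_trans (leq_card_setU _ _).
  apply/subset_leq_card/subsetP=> _ /imsetP[x Px ->].
  by rewrite inE; case: (boolP (_ \in I)) => //= Ix; apply: imset_f; rewrite inE Px.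
have cardD := cardsID R P; rewrite (setIidPr sRP) in cardD.
have arith i j k b d r n : i <= j + k -> b <= d -> 2 * k <= b -> 2 * j <= r ->
  r + d = n -> 2 * i <= n by lia.
exact: arith leP (subset_leq_card sBPR) leB leR cardD.
Qed.

Lemma odd_qgroup_cent_small p q R A : prime p -> prime q -> odd q -> q != p ->
    p.-group R -> q.-group A -> A \subset 'N(R) -> ~~ (A \subset 'C(R)) ->
  4 * #|'C_R(A)| <= #|R|.
Proof.
move=> p_pr q_pr oq neq pR qA nRA ncA.
(* The index of ['C_R(A)] in [R] is 1 modulo [q] but not 1, so it is at least [q + 1]. *)
have := pgroup_fix_mod qA (_ : [acts A, on R | 'J]).
rewrite afixJ astabsJ => /(_ nRA)/eqP.
rewrite eqn_mod_dvd ?subset_leq_card ?subsetIl //.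
rewrite -(Lagrange (subsetIl R 'C(A))) -{2}[#|_|]muln1 -mulnBr.
rewrite Gauss_dvdr; last first.
  rewrite prime_coprime // -p'natE //; apply: pi_pnat (pgroupS (subsetIl _ _) pR) _.
  by rewrite !inE eq_sym.
have: 1 < #|R : 'C_R(A)|.
  by rewrite indexg_gt1 subsetI subxx /= centsC.
case: #|R : _| => [|[|n]] //= _; rewrite subSS subn0 => /dvdn_leq -/(_ isT) le_q.
rewrite mulnC leq_mul //.
have := odd_prime_gt2 oq q_pr; lia.
Qed.

End Fusion.

(** * Frobenius' normal p-complement theorem, by transfer *)

Section Frobenius.

Import GRing.Theory FiniteModule.

Set Implicit Arguments.
Unset Strict Implicit.

Variable gT : finGroupType.
Implicit Types (G H N K P Q R S A B : {group gT}) (p q : nat) (pi : nat_pred).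

Lemma Sylow_sub_index q N K B : q.-Sylow(N) B -> B \subset K -> q^'.-nat #|N : K|.
Proof. by case/and3P=> _ _ q'NB sBK; apply: pnat_dvd q'NB; apply: indexgS. Qed.

(** For a prime [q] outside [pi], [K] contains a Sylow [q]-subgroup of [N]. *)
Lemma pi'_elt_sub_index pi N K :
  {in N, forall x, pi^'.-elt x -> x \in K} -> pi.-nat #|N : K|.
Proof.
move=> pi'K; apply/pnatP=> // q q_pr q_dv; apply/negPn/negP=> pi'q.
have [B sylB] := Sylow_exists q N.
have: q^'.-nat #|N : K|.
  apply: Sylow_sub_index (sylB) _; apply/subsetP=> x Bx; apply: pi'K.
    exact: (subsetP (pHall_sub sylB)).
  by apply: pi_pnat (mem_p_elt (pHall_pgroup sylB) Bx) _.
by rewrite p'natE // q_dv.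
Qed.

Lemma Sylow_mul_pindex p N K S : p.-Sylow(N) S -> K <| N -> p.-nat #|N : K| ->
  S * K = N.
Proof.
move=> sylS nKN pNK; have nKS := subset_trans (pHall_sub sylS) (normal_norm nKN).
rewrite (normC nKS) -quotientK // -[RHS](quotientGK nKN); congr (_ @*^-1 _).
apply: (pHall_id (quotient_pHall nKS sylS)).
by rewrite /pgroup card_quotient ?normal_norm.
Qed.

Variable p : nat.

(** Frobenius' hypothesis: G induces a p-group of automorphisms on each of its p-subgroups. *)
Definition automizers_pgroup G := forall Q : {group gT},
  Q \subset G -> p.-group Q -> p.-nat #|'N_G(Q) : 'C_G(Q)|.

Lemma automizers_pgroupS G H : H \subset G -> automizers_pgroup G -> automizers_pgroup H.
Proof.
move=> sHG autG Q sQH pQ; have := autG Q (subset_trans sQH sHG) pQ.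
apply: pnat_dvd; have sN: 'N_H(Q) \subset 'N_G(Q) by apply: setSI.
have nC := normal_norm (subcent_normal G Q).
have -> : #|'N_H(Q) : 'C_H(Q)| = #|'N_H(Q) : 'C_G(Q)|.
  rewrite -[RHS]indexgI /=; congr #|_ : _|.
  by rewrite setIACA (setIidPl sHG) (setIidPr (cent_sub Q)).
rewrite -!card_quotient ?cardSg ?quotientS //.
exact: subset_trans sN nC.
Qed.

Lemma Sylow_conj_cent G P Q : automizers_pgroup G ->
    p.-Sylow(G) P -> p.-Sylow(G) Q ->
  exists2 c, c \in 'C_G(P :&: Q) & Q :=: P :^ c.
Proof.
(* Normalisers grow in [P] and [Q], so both can be moved to Sylow subgroups whose
   intersection with them exceeds [D = P :&: Q]; Sylow's theorem in ['N_G(D)]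
   connects these, with a conjugating element which can be taken in ['C_G(D)]. *)
move=> autG.
have [n] := ubnP (#|G| - #|P :&: Q|); elim: n => // n IHn in P Q *.
rewrite ltnS => le_n sylP sylQ; set D := P :&: Q in le_n *.
have [sPG pP _] := and3P sylP; have [sQG pQ _] := and3P sylQ.
have eqPQ: #|P| = #|Q| by rewrite (card_Hall sylP) (card_Hall sylQ).
have [sPQ | nsPQ] := boolP (P \subset Q).
  exists 1; first exact: group1.
  by rewrite conjsg1; apply/eqP; rewrite eq_sym eqEcard sPQ eqPQ /=.
have ltDP: D \proper P.
  by rewrite properEneq subsetIl andbT; apply: contra nsPQ => /eqP/setIidPl.
have ltDQ: D \proper Q.
  rewrite properEneq subsetIr andbT; apply: contra nsPQ => /eqP/setIidPr sQP.
  by rewrite (_ : P :=: Q) //; apply/eqP; rewrite eq_sym eqEcard sQP eqPQ /=.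
have sDG : D \subset G := subset_trans (proper_sub ltDP) sPG.
have pD : p.-group D := pgroupS (proper_sub ltDP) pP.
have gtP := nilpotent_proper_norm (pgroup_nil pP) ltDP.
have gtQ := nilpotent_proper_norm (pgroup_nil pQ) ltDQ.
have sNP: 'N_P(D) \subset 'N_G(D) := setSI 'N(D) sPG.
have [S sylS sPS] := Sylow_superset sNP (pgroupS (subsetIl _ _) pP).
have sNQ: 'N_Q(D) \subset 'N_G(D) := setSI 'N(D) sQG.
have [T sylT sQT] := Sylow_superset sNQ (pgroupS (subsetIl _ _) pQ).
have sSG: S \subset G := subset_trans (pHall_sub sylS) (subsetIl _ _).
have sTG: T \subset G := subset_trans (pHall_sub sylT) (subsetIl _ _).
have [R sylR sSR] := Sylow_superset sSG (pHall_pgroup sylS).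
have [U sylU sTU] := Sylow_superset sTG (pHall_pgroup sylT).
(* The induction hypothesis for Sylow subgroups sharing some [E] larger than [D]. It links [P] to
   [R], a conjugate of [R] to [U], and [U] to [Q]. *)
have IH P1 Q1 (E : {group gT}) : p.-Sylow(G) P1 -> p.-Sylow(G) Q1 ->
    D \proper E -> E \subset P1 -> E \subset Q1 ->
    exists2 c, c \in 'C_G(D) & Q1 :=: P1 :^ c.
  move=> sylP1 sylQ1 ltDE sEP1 sEQ1.
  have sE: E \subset P1 :&: Q1 by rewrite subsetI sEP1.
  have [|c] := IHn P1 Q1 _ sylP1 sylQ1.
    apply: leq_trans le_n; apply: ltn_sub2l.
      by rewrite (leq_trans (proper_card ltDP)) ?subset_leq_card.
    by rewrite (leq_trans (proper_card ltDE)) ?subset_leq_card.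
  case/setIP=> Gc cc defQ1; exists c => //; rewrite inE Gc.
  by apply: (subsetP (centS _)) cc; apply: subset_trans sE; apply: proper_sub.
have [c1 Cc1 defR] :=
  IH P R 'N_P(D)%G sylP sylR gtP (subsetIl _ _) (subset_trans sPS sSR).
have [c2 Cc2 defQ] :=
  IH U Q 'N_Q(D)%G sylU sylQ gtQ (subset_trans sQT sTU) (subsetIl _ _).
have nC := subcent_normal G D.
have [m Nm defT] := Sylow_trans sylS sylT.
have: m \in S * 'C_G(D) by rewrite (Sylow_mul_pindex sylS nC) ?autG.
case/mulsgP=> s c Ss Cc defm.
have {}defT: T :=: S :^ c by rewrite defT defm conjsgM (conjGid Ss).
have [c3 Cc3 defU] : exists2 c, c \in 'C_G(D) & U :=: R :^ c.
  have [||d Cd defU] := IH (R :^ c)%G U 'N_Q(D)%G _ sylU gtQ _ (subset_trans sQT sTU).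
  - by rewrite pHallJ //; case/setIP: Cc.
  - by rewrite (subset_trans sQT) // defT conjSg.
  by exists (c * d); rewrite ?groupM // conjsgM.
by exists (c1 * c3 * c2); rewrite ?groupM // !conjsgM -defR -defU.
Qed.

(** As [x] lies in both [P] and its conjugate by [g^-1], some [c] centralising [x] carries the first
    to the second. Then [c * g] normalises [P], and ['N_G(P) = 'C_G(P) * P] supplies [u]. *)
Lemma Sylow_fusion_control G P x g : automizers_pgroup G -> p.-Sylow(G) P ->
  x \in P -> g \in G -> x ^ g \in P -> exists2 u, u \in P & x ^ g = x ^ u.
Proof.
move=> autG sylP Px Gg Pxg; have [sPG pP _] := and3P sylP.
have sylPg: p.-Sylow(G) (P :^ g^-1)%G by rewrite pHallJ ?groupV.
have [c /setIP[Gc cc] defPg] := Sylow_conj_cent autG sylP sylPg.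
have cxc: x ^ c = x.
  apply/conjg_fixP/commgP/esym/(centP cc); rewrite inE Px mem_conjg invgK //.
have Nd: c * g \in 'N_G(P).
  by rewrite inE groupM //= inE conjsgM -defPg conjsgKV.
have nC := subcent_normal G P.
have: c * g \in 'C_G(P) * P.
  have sylPN: p.-Sylow('N_G(P)) P by rewrite Sylow_subnorm.
  have nCP := subset_trans (pHall_sub sylPN) (normal_norm nC).
  by rewrite -(normC nCP) (Sylow_mul_pindex sylPN nC) ?autG.
case/mulsgP=> d u /setIP[_ cd] Pu defcg; exists u => //.
rewrite -{1}cxc -conjgM defcg conjgM; congr (_ ^ _).
by apply/conjg_fixP/commgP/esym/(centP cd).
Qed.

(* As [P] controls its own fusion, the transfer of [G] into [P / P^`(1)] maps
   [g] in [P] to the coset of [g ^+ #|G : P|]; its kernel is the wanted [K]. *)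
Lemma Sylow_transfer G P : automizers_pgroup G -> p.-Sylow(G) P ->
  exists K : {group gT}, [/\ K <| G, P :&: K \subset P^`(1) & p.-nat #|G : K|].
Proof.
move=> autG sylP; have [sPG pP p'GP] := and3P sylP.
pose alpha := restrm_morphism (der_norm 1 P) (coset_morphism P^`(1)).
have alphaP : alpha @* P = P / P^`(1) by rewrite morphim_restrm setIid.
have abA: abelian (alpha @* P) by rewrite alphaP der_abelian.
have pA: p.-group (alpha @* P) by rewrite morphim_pgroup.
pose V := transfer G abA.
exists ('ker V)%G; split; first exact: ker_normal.
  apply/subsetP=> g /setIP[Pg kVg]; have Gg := subsetP sPG g Pg.
  have trX := transversalP (rcosets_cycle_partition sPG Gg).
  set X := transversal _ _ in trX.
  have Ag: alpha g \in alpha @* P by apply: mem_morphim.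
  have Vg: V g = (fmod abA (alpha g) *+ #|G : P|)%R.
    rewrite /V (transfer_cycle_expansion sPG abA Gg trX).
    rewrite -(sum_index_rcosets_cycle sPG Gg trX) -sumrMnr; apply: eq_bigr => x Xx.
    have Gx: x \in G by apply: (subsetP (transversal_sub trX)).
    set n := #|_ : _|; have Pgnx: (g ^+ n) ^ x^-1 \in P.
      by rewrite conjgE invgK mulgA -mem_rcoset mulg_exp_card_rcosets.
    (* The conjugator [x^-1] is replaced by [u] in [P], which has no effect in the abelian image. *)
    have [u Pu ->] := Sylow_fusion_control autG sylP (groupX n Pg) (groupVr Gx) Pgnx.
    rewrite -[LHS]/(fmod abA (alpha (g ^+ n ^ u))).
    rewrite morphJ ?groupX // morphX // conjgE.
    rewrite (centsP abA (alpha g ^+ n)) ?groupX ?mem_morphim // mulKg.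
    by rewrite fmodX.
  have Ag1: alpha g = 1.
    have V0 : V g = 0%R := mker kVg.
    have /eqP : alpha g ^+ #|G : P| = 1 by rewrite -(fmodK abA Ag) -fmvalZ -Vg V0.
    rewrite -order_dvdn => /pnat_dvd/(_ p'GP) p'g.
    by apply/eqP; rewrite -order_eq1 (pnat_1 (mem_p_elt pA Ag) p'g).
  by rewrite coset_idr ?(subsetP (der_norm 1 P)).
(* Every p'-element has trivial transfer, the target being a p-group. *)
apply: pi'_elt_sub_index => x Gx p'x; apply/kerP => //.
have p'Vx: p^'.-elt (fmval (V x)).
  rewrite -[fmval _]/(fmval_morphism abA (transfer_morphism G abA x)).
  by rewrite !morph_p_elt ?inE.
have pVx: p.-elt (fmval (V x)) := mem_p_elt pA (fmodP _).
by apply: val_inj; apply/eqP; rewrite -order_eq1 (pnat_1 pVx p'Vx).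
Qed.

(** Induction on [#|G|]: if [P] is nontrivial, its derived subgroup is proper, so the transfer
    kernel [K] is proper. The p-complement of [K] is characteristic in [K], and [K] has p-power
    index in [G]. *)
Theorem normal_p_complement G : automizers_pgroup G -> p^'.-Hall(G) 'O_p^'(G).
Proof.
have [n] := ubnP #|G|; elim: n => // n IHn in G *; rewrite ltnS => le_n autG.
have [P sylP] := Sylow_exists p G; have [sPG pP p'GP] := and3P sylP.
have [P1 | ntP] := eqVneq P 1%G.
  have p'G: p^'.-group G by rewrite -partG_eq1 -(card_Hall sylP) P1 cards1.
  by rewrite pcore_pgroup_id // /pHall subxx indexgg p'G.
have [K [nKG sPK pGK]] := Sylow_transfer autG sylP.
have ltKG: K \proper G.
  have /properP[_ [x Px P'x]] := sol_der1_proper (pgroup_sol pP) (subxx P) ntP.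
  apply/properP; split; first exact: normal_sub.
  exists x; first exact: (subsetP sPG).
  by apply: contra P'x => Kx; rewrite (subsetP sPK) // inE Px.
have [||sOK p'O pKO] := and3P (IHn K _ _).
- exact: leq_trans (proper_card ltKG) le_n.
- exact: automizers_pgroupS (normal_sub nKG) autG.
have nOG: 'O_p^'(K) <| G := char_normal_trans (pcore_char _ _) nKG.
have hallO: p^'.-Hall(G) 'O_p^'(K).
  rewrite /pHall (normal_sub nOG) pcore_pgroup -(Lagrange_index (normal_sub nKG) sOK).
  by rewrite pnatM pKO pnatNK pGK.
by rewrite (normal_Hall_pcore hallO nOG).
Qed.

End Frobenius.

(** * Local consequences of d_p(G) > 1/2 *)

Section Density.

Set Implicit Arguments.
Unset Strict Implicit.

Variables (gT : finGroupType) (p : nat) (G : {group gT}).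
Hypotheses (p_pr : prime p) (dG : #|G|`_p < 2 * pi_class_number p G).
Implicit Types (N P Q R S A B : {group gT}).

Lemma Sylow_fusion_large P : p.-Sylow(G) P ->
  #|P| < 2 * #|[set x ^: G | x in P]|.
Proof.
move=> sylP; rewrite (card_Hall sylP); apply: leq_trans dG _.
by rewrite leq_mul2l pi_class_number_Sylow.
Qed.

Lemma odd_Sylow_abelian P : odd p -> p.-Sylow(G) P -> abelian P.
Proof.
move=> odd_p sylP; have [sPG pP _] := and3P sylP.
apply: contraLR (Sylow_fusion_large sylP) => ncP; rewrite -leqNgt.
apply: (@odd_fusion_bound _ _ P P) => //; rewrite ?normG ?(odd_pgroup_odd odd_p pP) //.
rewrite -[X in _ <= X](Lagrange (center_sub P)) mulnC leq_mul2l; apply/orP; right.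
rewrite -card_quotient ?gFnorm //; have pPZ := quotient_pgroup 'Z(P) pP.
have ncPZ: ~~ cyclic (P / 'Z(P)).
  by apply: contra ncP; apply: cyclic_center_factor_abelian.
have:= card_pgroup pPZ; case: (logn _ _) => [|[|k]] oPZ.
- by rewrite (card1_trivg oPZ) cyclic1 in ncPZ.
- by rewrite prime_cyclic ?oPZ in ncPZ.
rewrite oPZ !expnS mulnA -[4]muln1 leq_mul ?expn_gt0 ?prime_gt0 //.
by rewrite (@leq_mul 2 2) ?prime_gt1.
Qed.

Lemma no_odd_automorphism q R S B : prime q -> odd q -> q != p ->
    p.-Sylow(G) S -> R \subset S -> 'Z(S) \subset R ->
  B \subset 'N_G(R) -> q.-group B -> B \subset 'C(R).
Proof.
move=> q_pr odd_q neq sylS sRS sZR /subsetIP[sBG nRB] qB.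
have [sSG pS _] := and3P sylS.
apply: contraLR (Sylow_fusion_large sylS) => ncB; rewrite -leqNgt.
apply: (center_fusion_bound sSG sRS sZR).
apply: (odd_fusion_bound sBG nRB (odd_pgroup_odd odd_q qB)).
exact: (odd_qgroup_cent_small p_pr q_pr odd_q neq (pgroupS sRS pS) qB nRB ncB).
Qed.

(** The index condition makes Sylow p-subgroups of [N] Sylow in [G], so the density of [G] applies;
    the parity condition forces any prime other than [p] dividing an automizer to be odd. [Q] is
    enlarged to a Sylow subgroup [R] of [Q <*> C] so as to contain the centre of a Sylow subgroup of
    [G]. *)
Lemma density_automizers_pgroup N : N \subset G -> p^'.-nat #|G : N| ->
  odd (#|N|`_p^') -> automizers_pgroup p N.
Proof.
move=> sNG p'GN oddN Q sQN pQ; apply/pnatP=> // q q_pr q_dv.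
rewrite inE /=; apply/negPn/negP=> neq.
set L := 'N_N(Q) in q_dv; set C := 'C_N(Q) in q_dv.
have nCL: C <| L := subcent_normal N Q.
have sLN: L \subset N := subsetIl _ _.
have q'C: ~~ q^'.-nat #|L : C| by rewrite p'natE // q_dv.
have odd_q: odd q.
  apply: dvdn_odd oddN; rewrite -(part_pnat_id (_ : p^'.-nat q)) ?pnatE //.
  by rewrite partn_dvd // (dvdn_trans q_dv) // (dvdn_trans (dvdn_indexg _ _)) ?cardSg.
have nQC: C \subset 'N(Q) by rewrite subIset // cent_sub orbT.
have nQL: Q <| L by rewrite /normal subsetIr subsetI sQN normG.
have nML: (Q <*> C)%G <| L by rewrite normalY.
set M := (Q <*> C)%G in nML; have [sML nMn] := andP nML.
have [R sylR] := Sylow_exists p M; have [sRM pR _] := and3P sylR.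
have sQR: Q \subset R.
  apply: subset_trans (pcore_max pQ _) (pcore_sub_Hall sylR).
  by apply: normalS nQL => //; apply: joing_subl.
have [S sylSN sRS] := Sylow_superset (subset_trans sRM (subset_trans sML sLN)) pR.
have [sSN pS p'NS] := and3P sylSN.
have sylS: p.-Sylow(G) S.
  by rewrite /pHall (subset_trans sSN) // pS -(Lagrange_index sNG sSN) pnatM p'GN.
(* ['Z(S)] centralises [Q], hence lies in [M]; [R <*> 'Z(S)] is then a p-subgroup of [M], and [R] is
   Sylow there. *)
have sZR: 'Z(S) \subset R.
  have sK: (R <*> 'Z(S))%G \subset M.
    rewrite join_subG sRM /=; apply: subset_trans (joing_subr _ _).
    rewrite subsetI (subset_trans (center_sub S)) //=.
    exact: subset_trans (subsetIr _ _) (centS (subset_trans sQR sRS)).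
  have pK: p.-group (R <*> 'Z(S)).
    by apply: pgroupS pS; rewrite join_subG sRS center_sub.
  by rewrite -(sub_pHall sylR pK (joing_subl _ _) sK) joing_subr.
have [B sylB] := Sylow_exists q 'N_L(R).
have [sBL qB _] := and3P sylB.
have cRB: B \subset 'C(R).
  apply: no_odd_automorphism sylS sRS sZR _ qB => //.
  by apply: subset_trans sBL (setSI _ (subset_trans sLN sNG)).
have sBM: B \subset M.
  apply: subset_trans (joing_subr _ _); rewrite subsetI.
  rewrite (subset_trans cRB (centS sQR)) andbT.
  exact: subset_trans sBL (subset_trans (subsetIl _ _) sLN).
(* By Frattini [L = M * 'N_L(R)], and the Sylow [q]-subgroup [B] of ['N_L(R)] lies in [M], so [q]
   does not divide [#|L : M|]; [#|M : C|] is a power of [p]. *)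
case/negP: q'C; rewrite -(Lagrange_index sML (joing_subr _ _)) pnatM; apply/andP; split.
  have := Sylow_sub_index sylB sBM.
  rewrite -!card_quotient //; last by rewrite subIset ?nMn.
  by rewrite -(quotientMidl M 'N_L(R)) (Frattini_arg nML sylR).
rewrite -card_quotient; last exact: subset_trans sML (normal_norm nCL).
rewrite /= joingC quotientYidl; last first.
  by rewrite (subset_trans (normal_sub nQL)) ?normal_norm.
by apply: pi_pnat (quotient_pgroup C pQ) _; rewrite !inE eq_sym.
Qed.

End Density.

(** * Combining the primes *)

(** ['O_pi^'(N)] is the intersection in [N] of the p-complements. Each contains the derived subgroup
    of [N], since its quotient is an image of an abelian Sylow subgroup. *)
Lemma pi_complement_of_p_complements (gT : finGroupType) (N : {group gT}) (pi : nat_pred) :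
    (forall p : nat, p \in pi -> p^'.-Hall(N) 'O_p^'(N)) ->
    (forall (p : nat) (P : {group gT}), p \in pi -> p.-Sylow(N) P -> abelian P) ->
  pi^'.-Hall(N) 'O_pi^'(N) /\ abelian (N / 'O_pi^'(N)).
Proof.
move=> hallO abP; rewrite /pHall pcore_pgroup pcore_sub /= /pgroup; split.
  rewrite pnatNK; apply: pi'_elt_sub_index => x Nx pi'x.
  rewrite /= -bigcap_p'core inE Nx; apply/bigcapP=> p pi_p.
  rewrite (mem_normal_Hall (hallO _ pi_p) (pcore_normal _ _)) //.
  by apply: sub_in_pnat pi'x => q _; apply: contra => /eqnP->.
apply: sub_der1_abelian.
rewrite /= -bigcap_p'core subsetI der_sub; apply/bigcapsP=> p pi_p.
have [P sylP] := Sylow_exists p N.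
apply: der1_min; first exact: gFnorm.
have [sON _ pNO] := and3P (hallO _ pi_p); rewrite pnatNK in pNO.
have := Sylow_mul_pindex sylP (pcore_normal _ _) pNO.
move/(congr1 (fun A => A / 'O_p^'(N))); rewrite quotientMidr => <-.
by rewrite quotient_abelian // (abP p).
Qed.

Theorem theoremC (gT : finGroupType) (G : {group gT}) (pi : nat_pred)
    (pi_prime : forall p : nat, p \in pi -> prime p)
    (pi2 : 2 \in pi)
    (hd : (1 / 2 < pi_class_density pi G)%R) :
  (exists N : {group gT}, normal_pi_complement pi G N) /\
  (exists H : {group gT}, [predD1 pi & 2].-Hall(G) H /\ abelian H).
Proof.
have dp p : p \in pi -> #|G|`_p < 2 * pi_class_number p G.
  by move=> pi_p; apply: pi_class_density_gt_half_prime hd => //; apply: pi_prime.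
set sigma := [predD1 pi & 2].
pose N := 'O_2^'(G)%G; have nNG : N <| G := pcore_normal _ _.
have sNG := normal_sub nNG.
have hallN: 2^'.-Hall(G) N.
  (* For p = 2 the parity condition is automatic; for odd p the odd order of [N] provides it. *)
  apply: normal_p_complement => //.
  apply: (@density_automizers_pgroup _ 2 G _ (dp 2 pi2)) => //.
    by rewrite indexgg.
  by rewrite odd_2'nat part_pnat.
have [_ oddN twoGN] := and3P hallN; rewrite pnatNK in twoGN.
have sigma_p p : p \in sigma -> [/\ p \in pi, prime p, odd p & p^'.-nat #|G : N|].
  rewrite !inE => /andP[neq2 pi_p]; have p_pr := pi_prime p pi_p; split=> //.
    by case: (even_prime p_pr) => // eq2; rewrite eq2 in neq2.
  by apply: sub_in_pnat twoGN => q _; rewrite !inE => /eqP->; rewrite eq_sym.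
have [||hallK abNK] := @pi_complement_of_p_complements gT N sigma.
- move=> p /sigma_p[pi_p p_pr odd_p p'GN]; apply: normal_p_complement => //.
  apply: (density_automizers_pgroup p_pr (dp p pi_p)) => //.
  by rewrite odd_2'nat (pnat_dvd (dvdn_part _ _)).
- move=> p P /sigma_p[pi_p p_pr odd_p p'GN] sylP.
  apply: (odd_Sylow_abelian p_pr (dp p pi_p)) => //.
  have [sPN pP p'NP] := and3P sylP.
  by rewrite /pHall (subset_trans sPN) // pP -(Lagrange_index sNG sPN) pnatM p'GN.
set K := 'O_sigma^'(N)%G in hallK abNK.
have [sKN s'K sNK] := and3P hallK; rewrite pnatNK in sNK.
have sigma_pi : {subset sigma <= pi} by move=> p /sigma_p[].
have piGK: pi.-nat #|G : K|.
  rewrite -(Lagrange_index sNG sKN) pnatM; apply/andP; split.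
    by apply: sub_in_pnat twoGN => q _ /eqnP->.
  by apply: sub_in_pnat sNK => q _; apply: sigma_pi.
(* Primes of [sigma] are excluded by the choice of [K], and 2 by the odd order of [N]. *)
have pi'K: pi^'.-group K.
  apply/pgroupP=> q q_pr q_dv; apply/negP=> pi_q.
  have: q \in sigma^' by apply: (pgroupP s'K).
  rewrite !inE pi_q andbT negbK => /eqP eq2.
  have := pgroupP (pgroupS sKN oddN) q q_pr q_dv.
  by rewrite eq2.
split.
  exists K; rewrite /normal_pi_complement pi'K /=.
  rewrite (char_normal_trans (pcore_char _ _) nNG) /=.
  rewrite -(Lagrange (subset_trans sKN sNG)) partnM //.
  by rewrite part_p'nat // mul1n part_pnat_id.
have [H] := splitsP (SchurZassenhaus_split (pHall_Hall hallK) (pcore_normal _ _)).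
case/complP=> tiKH defN; exists H.
have sHN: H \subset N by rewrite -defN mulG_subr.
have nKN: N \subset 'N(K) := gFnorm _ _.
have isoH: H \isog N / K.
  by rewrite -defN quotientMidl quotient_isog // (subset_trans sHN).
split; last by rewrite (isog_abelian isoH).
rewrite /pHall (subset_trans sHN sNG) (isog_pgroup _ isoH).
rewrite /pgroup card_quotient // sNK /=.
(* [#|G : N|] is a power of 2 and [#|N : H| = #|K|], so no prime of [sigma] divides [#|G : H|]. *)
rewrite -(Lagrange_index sNG sHN) pnatM; apply/andP; split.
  by apply: sub_in_pnat twoGN => q _ /eqnP->; rewrite !inE.
by rewrite -divgS // -defN (TI_cardMg tiKH) mulnK.
Qed.
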